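(* Let $n,d\ge 1$ be integers and put $m_1=n+1$, $m_2=n(d-1)+1$. There exists an affine map $\Phi:\mathbb{R}^d\to\mathbb{R}^{m_1\times m_2}$ such that the map $$f_{conv}:\mathbb{R}^{n\times d}\to\mathbb{R}^{m_1\times m_2},\qquad f_{conv}(X)=\Phi(X_1)\circledast\Phi(X_2)\circledast\cdots\circledast\Phi(X_n),$$ where $X_1,\dots,X_n\in\mathbb{R}^d$ are the rows of $X$ and $\circledast$ is two-dimensional circular convolution on $\mathbb{R}^{m_1\times m_2}$, is invariant and separating for multisets of $n$ vectors in $\mathbb{R}^d$. In particular the number of separators is $m=m_1m_2=(n+1)(n(d-1)+1)\in O(n^2d)$.
   Context: The symmetric group $S_n$ acts on $\mathbb{R}^{n\times d}$ by permuting rows: $[\sigma.X]_{ij}=X_{\sigma^{-1}(i)j}$. A map $f$ on $\mathbb{R}^{n\times d}$ is invariant if $f(\sigma.X)=f(X)$ for all $\sigma\in S_n$ and all $X$; it is separating if $f(X)=f(Y)$ implies that there is $\sigma\in S_n$ with $Y=\sigma.X$ (equivalently, the multisets of rows of $X$ and $Y$ coincide). Index entries of elements of $\mathbb{R}^{m_1\times m_2}$ by $(a,b)$ with $0\le a\le m_1-1$, $0\le b\le m_2-1$. The two-dimensional circular convolution of $A,B\in\mathbb{R}^{m_1\times m_2}$ is $(A\circledast B)_{a,b}=\sum A_{a',b'}B_{a'',b''}$, the sum being over all index pairs with $a'+a''\equiv a\pmod{m_1}$ and $b'+b''\equiv b\pmod{m_2}$; this operation is commutative and associative. *)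

(* Defs.v *)
From HB Require Import structures.
From mathcomp Require Import all_boot all_order all_algebra all_fingroup.
From mathcomp Require Import all_classical all_reals all_analysis.

Set Implicit Arguments.
Unset Strict Implicit.
Unset Printing Implicit Defensive.

Import Order.TTheory GRing.Theory Num.Theory.
Import numFieldNormedType.Exports.

Local Open Scope classical_set_scope.
Local Open Scope ring_scope.

Definition is_affine (R : pzRingType) (U V : lmodType R) (Phi : U -> V) : Prop :=
  exists (L : {linear U -> V}) (c : V), forall x, Phi x = L x + c.

Section RowAction.
Variables (R : Type) (n d : nat).

(* [row_perm s A i j = A (s i) j], so the inverse turns this into the left
   action [(s . X) i j = X (s^-1 i) j]. *)
Definition row_act (s : 'S_n) (X : 'M[R]_(n, d)) : 'M[R]_(n, d) :=
  row_perm s^-1%g X.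

Definition row_invariant (T : Type) (f : 'M[R]_(n, d) -> T) : Prop :=
  forall (s : 'S_n) (X : 'M[R]_(n, d)), f (row_act s X) = f X.

Definition row_separating (T : Type) (f : 'M[R]_(n, d) -> T) : Prop :=
  forall X Y : 'M[R]_(n, d), f X = f Y -> exists s : 'S_n, Y = row_act s X.

End RowAction.

Section CircularConvolution.
Variables (R : comPzRingType) (m1 m2 : nat).
Implicit Types A B C : 'M[R]_(m1, m2).

Definition circ_conv A B : 'M[R]_(m1, m2) :=
  \matrix_(a, b)
    \sum_(a' < m1) \sum_(a'' < m1 | (a' + a'' == a %[mod m1])%N)
      \sum_(b' < m2) \sum_(b'' < m2 | (b' + b'' == b %[mod m2])%N)
        A a' b' * B a'' b''.

(* The unit of [circ_conv]: 1 at index (0, 0) and 0 elsewhere. *)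
Definition circ_conv1 : 'M[R]_(m1, m2) :=
  \matrix_(a, b) ((a == 0 :> nat) && (b == 0 :> nat))%:R.

Local Notation I := ('I_m1 * 'I_m2)%type.
Local Notation add_to p q c :=
  ((nat_of_ord p.1 + nat_of_ord q.1 == nat_of_ord c.1 %[mod m1])
  && (nat_of_ord p.2 + nat_of_ord q.2 == nat_of_ord c.2 %[mod m2]))%N.

Lemma circ_convE A B (c : I) :
  circ_conv A B c.1 c.2 =
  \sum_(p : I) \sum_(q : I | add_to p q c) A p.1 p.2 * B q.1 q.2.
Proof.
rewrite mxE -(pair_bigA _ (fun a' b' => \sum_(q : I | add_to (a', b') q c)
  A a' b' * B q.1 q.2)) /=.
apply: eq_bigr => a' _; rewrite exchange_big /=; apply: eq_bigr => b' _.
by rewrite pair_big.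
Qed.

Lemma circ_convC : commutative circ_conv.
Proof.
move=> A B; apply/matrixP => a b; rewrite -[a]/(a, b).1 -[in LHS]/((a, b).2).
rewrite -[in RHS]/((a, b).2) !circ_convE (exchange_big_dep xpredT) //=.
apply: eq_bigr => p _; apply: eq_big => [q|q _]; last exact: mulrC.
by rewrite addnC [(q.2 + _)%N]addnC.
Qed.

Lemma circ_conv1l : left_id circ_conv1 circ_conv.
Proof.
move=> A; apply/matrixP => a b; rewrite -[a]/(a, b).1 -[in LHS]/((a, b).2).
have m10 : (0 < m1)%N by apply: leq_ltn_trans (ltn_ord a).
have m20 : (0 < m2)%N by apply: leq_ltn_trans (ltn_ord b).
rewrite circ_convE (bigD1 (Ordinal m10, Ordinal m20)) //=.
rewrite [X in _ + X]big1 ?addr0 => [|[x y] nxy]; last first.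
  apply: big1 => q _; rewrite mxE /=.
  suff /negbTE -> : ~~ ((x == 0 :> nat) && (y == 0 :> nat)) by rewrite mul0r.
  by apply: contra nxy.
rewrite (big_pred1 (a, b)) => [|[x y]]; first by rewrite mxE mul1r.
by rewrite /= !add0n !modn_small.
Qed.

Lemma circ_convA : associative circ_conv.
Proof.
pose add (p q : I) : I :=
  (Ordinal (ltn_pmod (p.1 + q.1) (leq_ltn_trans (leq0n _) (ltn_ord p.1))),
   Ordinal (ltn_pmod (p.2 + q.2) (leq_ltn_trans (leq0n _) (ltn_ord p.2)))).
have convE A B c : circ_conv A B c.1 c.2 =
    \sum_p \sum_(q | c == add p q) A p.1 p.2 * B q.1 q.2.
  rewrite circ_convE; apply: eq_bigr => p _; apply: eq_bigl => q.
  rewrite [RHS]eq_sym [c]surjective_pairing xpair_eqE -!val_eqE /=.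
  by rewrite ![in LHS](modn_small (ltn_ord _)).
have addC p q : add p q = add q p.
  by congr pair; apply/val_inj; rewrite /= addnC.
have addA p q r : add p (add q r) = add (add p q) r.
  by congr pair; apply/val_inj; rewrite /= modnDmr modnDml addnA.
have conv3E A B C c : circ_conv A (circ_conv B C) c.1 c.2 =
    \sum_p \sum_q \sum_(r | c == add p (add q r))
      A p.1 p.2 * (B q.1 q.2 * C r.1 r.2).
  rewrite convE; apply: eq_bigr => p _.
  under eq_bigr do rewrite convE mulr_sumr.
  rewrite exchange_big /=; apply: eq_bigr => q _.
  under eq_bigr do rewrite mulr_sumr.
  rewrite (exchange_big_dep (fun r => c == add p (add q r))) /=; last first.
    by move=> s r /[swap] /eqP <-.
  apply: eq_bigr => r Hr; rewrite (big_pred1 (add q r)) // => s /=.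
  by case: (s =P _) => [->|]; rewrite ?Hr ?andbF.
move=> A B C; apply/matrixP => a b; set c : I := (a, b).
rewrite -[a]/c.1 -[b]/c.2 [circ_conv (circ_conv A B) C]circ_convC !conv3E.
rewrite [RHS]exchange_big /=; apply: eq_bigr => p _.
rewrite [RHS](exchange_big_dep xpredT) //=; apply: eq_bigr => q _.
apply: eq_big => [r|r _]; last by rewrite [RHS]mulrC mulrA.
by rewrite addA [add r _]addC.
Qed.

HB.instance Definition _ := Monoid.isComLaw.Build 'M[R]_(m1, m2)
  circ_conv1 circ_conv circ_convA circ_convC circ_conv1l.

End CircularConvolution.

(* [\big] folds to the right and ends with the unit [circ_conv1], so for
   [0 < n] this is the plain n-fold convolution product of the [Phi (X_i)]. *)
Definition f_conv (R : comPzRingType) (n d m1 m2 : nat)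
    (Phi : 'rV[R]_d -> 'M[R]_(m1, m2)) (X : 'M[R]_(n, d)) : 'M[R]_(m1, m2) :=
  \big[@circ_conv R m1 m2/@circ_conv1 R m1 m2]_(i < n) Phi (row i X).

Definition conv_rows (n : nat) : nat := n.+1.
Definition conv_cols (n d : nat) : nat := (n * (d - 1)).+1.

(* The number of real-valued coordinate functions of an [m1 x m2] matrix. *)
Definition num_separators (n d : nat) : nat :=
  #|{: 'I_(conv_rows n) * 'I_(conv_cols n d)}|.

(* Bounds near this filter are bounds at every pair (n, d) with n, d >= 1. *)
Definition dims_ge1 : filter_on (nat * nat) :=
  FilterType (globally [set nd : nat * nat | (1 <= nd.1)%N /\ (1 <= nd.2)%N])
    (globally_filter _).

(* Main.v *)
(* Encode x in R^d as the polynomial x(v) = x_0 + x_1 v + ... + x_(d-1) v^(d-1)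
   and let Phi(x) be the coefficient matrix of u + x(v).  The product of the
   n polynomials u + X_i(v) has degree at most n in u and n(d-1) in v, so the
   circular convolution never wraps around and f_conv X is the coefficient
   matrix of that product.  As a monic polynomial in u over the domain R[v], the
   product determines the multiset of its roots - X_i(v), hence that of the
   rows X_i. *)
Require Import Defs.
From HB Require Import structures.
From mathcomp Require Import all_boot all_order all_algebra all_fingroup.
From mathcomp Require Import all_classical all_reals all_analysis.
From mathcomp Require Import fraction zify.
Set Implicit Arguments.
Unset Strict Implicit.
Unset Printing Implicit Defensive.
Import Order.TTheory GRing.Theory Num.Theory.
Import numFieldNormedType.Exports.
Local Open Scope classical_set_scope.
Local Open Scope ring_scope.

(** For [i, j < m] the congruence leaves only [i + j = a] or [i + j >= m], and [F] vanishes in the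
    second case. So [j = a - i] alone survives when [i <= a], and nothing does when [i > a]. *)
Lemma sum_modn_nowrap (V : nmodType) (m a : nat) (F : nat -> nat -> V) :
    (a < m)%N -> (forall i j, (m <= i + j)%N -> F i j = 0) ->
  \sum_(i < m) \sum_(j < m | (i + j == a %[mod m])%N) F i j
    = \sum_(i < a.+1) F i (a - i)%N.
Proof.
move=> ltam F0; rewrite (big_ord_widen m (fun i => F i (a - i)%N)) //.
rewrite [RHS]big_mkcond; apply: eq_bigr => i _; rewrite ltnS.
case: leqP => [leia | ltai].
  have ltj : (a - i < m)%N by lia.
  rewrite (bigD1 (Ordinal ltj)) /= ?subnKC //.
  rewrite big1 ?addr0 // => j /andP[/eqP ij_a nej].
  apply: F0; rewrite leqNgt; apply: contra nej => lt_ij.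
  by move: ij_a; rewrite !modn_small // => ij_a; apply/eqP/val_inj => /=; lia.
rewrite big1 // => j /eqP ij_a; apply: F0; rewrite leqNgt; apply/negP => lt_ij.
by move: ij_a; rewrite !modn_small //; lia.
Qed.

(** Over a field a product of monic linear factors determines its roots, so the identity is carried
    to the fraction field of [D]; injectivity of [tofrac] brings the permutation back. *)
Lemma prod_XsubC_perm (D : idomainType) (s t : seq D) :
  \prod_(x <- s) ('X - x%:P) = \prod_(x <- t) ('X - x%:P) -> perm_eq s t.
Proof.
move=> /(congr1 (map_poly (tofrac (R := D)))); rewrite !rmorph_prod.
under eq_bigr do rewrite /= map_polyXsubC.
under [RHS]eq_bigr do rewrite /= map_polyXsubC.
rewrite -!(big_map (tofrac (R := D)) xpredT (fun x => 'X - x%:P)).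
move=> /prod_XsubC_eq; apply: perm_map_inj => x y /eqP.
by rewrite tofrac_eq => /eqP.
Qed.

Section BivariatePolynomials.
Variable R : comNzRingType.
Implicit Types (P Q : {poly {poly R}}).

(** The outer variable stands for u and the inner one for v. Bounding by vanishing coefficients
    needs no special case for the zero polynomial. *)
Definition bideg_le (k e : nat) P :=
  forall i j, ~~ ((i <= k) && (j <= e))%N -> P`_i`_j = 0.

Definition coef_mx (m1 m2 : nat) P : 'M[R]_(m1, m2) := \matrix_(a, b) P`_a`_b.

Lemma coef2M P Q i j :
  (P * Q)`_i`_j =
  \sum_(x < i.+1) \sum_(y < j.+1) P`_x`_y * Q`_(i - x)`_(j - y).
Proof. by rewrite coefM coef_sum; apply: eq_bigr => x _; rewrite coefM. Qed.

Lemma bideg_le1 : bideg_le 0 0 1.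
Proof.
move=> i j; rewrite coef1 !leqn0; case: (i == 0%N) => /= [/negbTE j0|_].
  by rewrite coef1 j0.
by rewrite coef0.
Qed.

Lemma bideg_leM k e k' e' P Q :
  bideg_le k e P -> bideg_le k' e' Q -> bideg_le (k + k') (e + e') (P * Q).
Proof.
move=> hP hQ i j hij; rewrite coef2M big1 // => x _; rewrite big1 // => y _.
have := ltn_ord x; have := ltn_ord y => hy hx.
have [hxy|/hP->] := boolP ((x <= k) && (y <= e))%N; last by rewrite mul0r.
by rewrite hQ ?mulr0 //; lia.
Qed.

Lemma coef_mx1 m1 m2 : coef_mx m1 m2 1 = circ_conv1 R m1 m2.
Proof.
apply/matrixP => a b; rewrite !mxE coef1.
by case: (a == 0%N :> nat); rewrite ?coef1 ?coef0.
Qed.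

Lemma coef_mx_inj m1 m2 P Q :
  bideg_le m1 m2 P -> bideg_le m1 m2 Q ->
  coef_mx m1.+1 m2.+1 P = coef_mx m1.+1 m2.+1 Q -> P = Q.
Proof.
move=> hP hQ /matrixP eqPQ; apply/polyP => i; apply/polyP => j.
have [/andP[hi hj]|nij] := boolP ((i <= m1) && (j <= m2))%N; last first.
  by rewrite hP ?hQ.
by have := eqPQ (inord i) (inord j); rewrite !mxE !inordK.
Qed.

(** Index pairs whose sum wraps around exceed [k + k'] in u or [e + e'] in v, so one of the two
    coefficients is zero. Both circular sums then reduce to Cauchy products, first in u, then in
    v. *)
Lemma circ_conv_coef_mx m1 m2 k e k' e' P Q :
    bideg_le k e P -> bideg_le k' e' Q -> (k + k' < m1)%N -> (e + e' < m2)%N ->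
  circ_conv (coef_mx m1 m2 P) (coef_mx m1 m2 Q) = coef_mx m1 m2 (P * Q).
Proof.
move=> hP hQ hm1 hm2; apply/matrixP => a b; rewrite !mxE coef2M.
have PQ0 x x' y y' : ((m1 <= x + x') || (m2 <= y + y'))%N ->
    P`_x`_y * Q`_x'`_y' = 0.
  move=> hxy; have [hPxy|/hP->] := boolP ((x <= k) && (y <= e))%N.
    by rewrite hQ ?mulr0 //; lia.
  by rewrite mul0r.
rewrite -(@sum_modn_nowrap R m1 a
  (fun x x' => \sum_(y < b.+1) P`_x`_y * Q`_x'`_(b - y))) //; last first.
  by move=> x x' hx; rewrite big1 // => y _; rewrite PQ0 ?hx.
apply: eq_bigr => x _; apply: eq_bigr => x' _.
rewrite -(@sum_modn_nowrap R m2 b (fun y y' => P`_x`_y * Q`_x'`_y')) //.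
  by apply: eq_bigr => y _; apply: eq_bigr => y' _; rewrite !mxE.
by move=> y y' hy; rewrite PQ0 ?hy ?orbT.
Qed.

Lemma bideg_le_prod (I : Type) (s : seq I) (F : I -> {poly {poly R}}) e :
    (forall i, bideg_le 1 e (F i)) ->
  bideg_le (size s) (size s * e) (\prod_(i <- s) F i).
Proof.
move=> hF; elim: s => [|i s IH] /=; first by rewrite big_nil; apply: bideg_le1.
by rewrite big_cons mulSn -add1n; apply: bideg_leM.
Qed.

Lemma circ_conv_prod (I : Type) (s : seq I) (F : I -> {poly {poly R}}) e m1 m2 :
    (forall i, bideg_le 1 e (F i)) -> (size s < m1)%N -> (size s * e < m2)%N ->
  \big[@circ_conv R m1 m2/@circ_conv1 R m1 m2]_(i <- s) coef_mx m1 m2 (F i)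
    = coef_mx m1 m2 (\prod_(i <- s) F i).
Proof.
move=> hF; elim: s => [|i s IH] /= hm1 hm2; first by rewrite !big_nil coef_mx1.
rewrite !big_cons IH; [|lia..].
by apply: circ_conv_coef_mx (hF i) (bideg_le_prod hF) _ _; lia.
Qed.

Definition row_factor d (x : 'rV[R]_d) : {poly {poly R}} :=
  'X + (rVpoly x)%:P.

Lemma bideg_le_row_factor d (x : 'rV[R]_d) : bideg_le 1 (d - 1) (row_factor x).
Proof.
move=> i j hij; rewrite coefD coefX coefC coefD coefMn coef1.
have [i1|_] := eqVneq i 1%N.
  rewrite i1 /= coef0 addr0 (_ : (j == 0%N) = false) //.
  by move: hij; rewrite i1 /=; lia.
rewrite mulr0n add0r; case: eqP => [i0|_]; last by rewrite coef0.
rewrite coef_rVpoly; case: insubP => // l ltj _.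
by move: hij; rewrite i0 /=; lia.
Qed.

(** The linear part of the affine encoding: x fills row 0, the coefficients of u^0. The constant
    part is the coefficient matrix of u. *)
Definition row_to_mx d m1 m2 (x : 'rV[R]_d) : 'M[R]_(m1, m2) :=
  coef_mx m1 m2 (rVpoly x)%:P.

Lemma row_to_mx_is_linear d m1 m2 : linear (@row_to_mx d m1 m2).
Proof.
move=> c x y; apply/matrixP => a b; rewrite !mxE !coefC linearP.
by case: (a == 0%N :> nat); rewrite ?coef0 ?mulr0 ?addr0 // coefD coefZ.
Qed.

HB.instance Definition _ d m1 m2 := GRing.isLinear.Build R 'rV[R]_d
  'M[R]_(m1, m2) _ (@row_to_mx d m1 m2) (@row_to_mx_is_linear d m1 m2).

Lemma coef_mx_row_factor_affine d m1 m2 :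
  is_affine (fun x : 'rV[R]_d => coef_mx m1 m2 (row_factor x)).
Proof.
exists (row_to_mx m1 m2 : {linear 'rV[R]_d -> _}), (coef_mx m1 m2 'X) => x.
by apply/matrixP => a b; rewrite !mxE coefD coefD addrC.
Qed.

End BivariatePolynomials.

(** Commutativity of [circ_conv] allows reindexing the product by [s], which cancels the inverse in
    [row_act]. *)
Lemma f_conv_invariant (R : comPzRingType) n d m1 m2
  (Phi : 'rV[R]_d -> 'M[R]_(m1, m2)) : row_invariant (@f_conv R n d m1 m2 Phi).
Proof.
move=> s X; rewrite /f_conv (reindex_perm s); apply: eq_bigr => i _.
by congr Phi; apply/rowP => j; rewrite !mxE permK.
Qed.

Lemma perm_rows_row_act (R : eqType) n d (X Y : 'M[R]_(n, d)) :
    perm_eq [seq row i X | i <- enum 'I_n] [seq row i Y | i <- enum 'I_n] ->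
  exists s : 'S_n, Y = row_act s X.
Proof.
rewrite perm_sym -[X in perm_eq _ X]/(val [tuple row i X | i < n]).
(* Here row i of [Y] is row [s i] of [X], whereas [row_act] permutes by the inverse. *)
move=> /tuple_permP[s eqYX]; exists s^-1%g.
have {eqYX} eqYX : [tuple row i Y | i < n] =
    [tuple tnth [tuple row i X | i < n] (s i) | i < n] by apply: val_inj.
apply/row_matrixP => i; have := congr1 (fun t => tnth t i) eqYX.
rewrite !tnth_mktuple => ->; apply/rowP => j.
by rewrite !mxE invgK.
Qed.

Lemma f_conv_separating (R : idomainType) n d m1 m2 :
    (n < m1)%N -> (n * (d - 1) < m2)%N ->
  row_separating (@f_conv R n d m1 m2
    (fun x => coef_mx m1 m2 (row_factor x))).
Proof.
case: m1 => // m1; case: m2 => // m2 hm1 hm2 X Y.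
have size_n : size (index_enum 'I_n) = n.
  by rewrite -[index_enum _]enumT size_enum_ord.
have hF (Z : 'M[R]_(n, d)) i : bideg_le 1 (d - 1) (row_factor (row i Z)).
  exact: bideg_le_row_factor.
(* [m1] and [m2] are now the predecessors of the dimensions, that is, the largest indices. *)
have hprod (Z : 'M[R]_(n, d)) : bideg_le m1 m2 (\prod_(i < n) row_factor (row i Z)).
  move=> i j hij; have := bideg_le_prod (s := index_enum 'I_n) (hF Z).
  by rewrite size_n; apply; lia.
rewrite /f_conv !(circ_conv_prod (hF _)) ?size_n //.
move=> /(coef_mx_inj (hprod X) (hprod Y)) eqXY.
apply: perm_rows_row_act.
(* The factor u + x(v) has root -x(v) in u, and this root determines x, so it suffices to compare
   the roots. *)
have inj_root : injective (fun x : 'rV[R]_d => - rVpoly x).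
  by move=> x y /oppr_inj /(can_inj rVpolyK).
apply: (perm_map_inj inj_root); apply: prod_XsubC_perm.
have prodE (Z : 'M[R]_(n, d)) :
    \prod_(p <- [seq - rVpoly x | x <- [seq row i Z | i <- enum 'I_n]])
      ('X - p%:P) = \prod_(i < n) row_factor (row i Z).
  rewrite !big_map -enumT big_enum; apply: eq_bigr => i _.
  by rewrite /row_factor polyCN opprK.
by rewrite !prodE.
Qed.

Lemma card_num_separators n d :
  num_separators n d = ((n + 1) * (n * (d - 1) + 1))%N.
Proof. by rewrite /num_separators card_prod !card_ord !addn1. Qed.

(** The bound is taken factor by factor: n + 1 <= 2n and n(d - 1) + 1 <= nd. *)
Lemma num_separators_le n d : (1 <= n)%N -> (1 <= d)%N ->
  (num_separators n d <= 2 * (n ^ 2 * d))%N.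
Proof.
move=> n1 d1; rewrite card_num_separators.
rewrite (_ : 2 * (n ^ 2 * d) = (2 * n) * (n * d))%N; last by rewrite expnS; lia.
apply: leq_mul; first lia.
by rewrite mulnBr muln1; have := leq_pmulr n d1; lia.
Qed.

Theorem theorem4p2 (R : realType) :
  (forall n d : nat, (1 <= n)%N -> (1 <= d)%N ->
    (exists Phi : 'rV[R]_d -> 'M[R]_(conv_rows n, conv_cols n d),
      [/\ is_affine Phi,
          row_invariant (@f_conv R n d _ _ Phi)
        & row_separating (@f_conv R n d _ _ Phi)])
    /\ num_separators n d = ((n + 1) * (n * (d - 1) + 1))%N)
  /\
  (fun nd : nat * nat => (num_separators nd.1 nd.2)%:R : R)
    =O_dims_ge1
  (fun nd : nat * nat => (nd.1 ^ 2 * nd.2)%:R : R).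
Proof.
split=> [n d _ _|].
  split; last exact: card_num_separators.
  exists (fun x => coef_mx _ _ (row_factor x)); split.
  - exact: coef_mx_row_factor_affine.
  - exact: f_conv_invariant.
  - exact: f_conv_separating.
(* The constant 2 of [num_separators_le] serves at every point with n, d >= 1, hence so does any
   [k > 2]. *)
apply/eqOP; exists 2; split=> // k gt2k [n d] /= [n1 d1].
rewrite !normr_nat; apply: le_trans (ler_wpM2r (ler0n _ _) (ltW gt2k)).
by rewrite -natrM ler_nat num_separators_le.
Qed.
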